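(* Let $n, w \ge 1$, let $P$ be a quantum program on $n$ qubits, let $\rho = |\psi\rangle\langle\psi|$ be an input state, and let $(\hat\rho, \delta) = \mathrm{TN}(\rho, P)$ be the output of the width-$w$ matrix-product-state approximation algorithm described in the context. Then the trace distance between the approximation $\hat\rho$ and the perfect output $[\![P]\!](\rho)$ is bounded by $\delta$: $$\big\|\hat\rho - [\![P]\!](\rho)\big\|_1 \le \delta .$$
   Context: Norm. $\|X\|_1 = \mathrm{tr}\sqrt{X^\dagger X}$ is the Schatten 1-norm; ''trace distance'' of $\rho,\sigma$ means $\|\rho-\sigma\|_1$ (no factor $1/2$). Programs. $P ::= \texttt{skip} \mid P_1;P_2 \mid U(q_1,\dots,q_k) \mid \texttt{if } q=|0\rangle \texttt{ then } P_0 \texttt{ else } P_1$, where $U$ is a unitary gate on the listed qubits; here gates act on one or two qubits. The semantics $[\![P]\!]$ is a map on $2^n\times 2^n$ matrices: $[\![\texttt{skip}]\!](\rho)=\rho$; $[\![P_1;P_2]\!](\rho)=[\![P_2]\!]([\![P_1]\!](\rho))$; $[\![U(q_1,\dots,q_k)]\!](\rho)=U\rho U^\dagger$ ($U$ extended by the identity on the other qubits); $[\![\texttt{if } q=|0\rangle \texttt{ then } P_0 \texttt{ else } P_1]\!](\rho)=[\![P_0]\!](M_0\rho M_0^\dagger)+[\![P_1]\!](M_1\rho M_1^\dagger)$, where $M_b$ is the projector $|b\rangle\langle b|$ on qubit $q$ tensored with the identity on the other qubits. MPS. A width-$w$ matrix product state (MPS) on $n$ qubits is given by row vectors $A_1^{(0)},A_1^{(1)}$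 of dimension $w$, $w\times w$ matrices $A_j^{(0)},A_j^{(1)}$ for $1<j<n$, and column vectors $A_n^{(0)},A_n^{(1)}$ of dimension $w$; it represents the vector $\sum_{i_1,\dots,i_n\in\{0,1\}} A_1^{(i_1)}A_2^{(i_2)}\cdots A_n^{(i_n)}\,|i_1\cdots i_n\rangle$. The algorithm $\mathrm{TN}$ (exact arithmetic). Maintain an MPS and an accumulated error, initially $0$. (1) Initialization: the MPS is initialized to the input unit vector $|\psi\rangle$. For a basis state $|s_1\cdots s_n\rangle$, put $A_k^{(s_k)}=E$, $A_k^{(1-s_k)}=0$, where $E$ has $(1,1)$ entry $1$ and all other entries $0$. (2) 1-qubit gate $G$ on qubit $i$: replace $A_i^{(s)}$ by $\sum_{s'\in\{0,1\}}G_{ss'}A_i^{(s')}$ for $s=0,1$. No error is added. (3) 2-qubit gate $G$ on adjacent qubits $i,i+1$: form the block matrix $M=(M_{kl})_{k,l\in\{0,1\}}$ with $M_{kl}=A_i^{(k)}A_{i+1}^{(l)}$, and $M'$ with blocks $M'_{ij}=\sum_{k,l}G_{ijkl}M_{kl}$. Take a singular value decomposition $M'=U\Sigma V^\dagger$ with singular values in decreasing order. Keep only the $w$ largest singular values (padding with zeros if there are fewer), forming the $w\times w$ diagonal matrix $\Sigma'$. The new blocks $A_i^{(0)},A_i^{(1)}$ are the two row blocks of the first $w$ columns of $U$. The new blocks $A_{i+1}^{(0)},A_{i+1}^{(1)}$ are the two column blocks of $\Sigma'$ times the first $w$ rows of $V^\dagger$. Finally rescale the MPS so that it represents a unit vector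 (the truncated vector is assumed nonzero, so that this is defined). If $|\phi\rangle$ is the unit vector obtained by applying $G$ to the state represented before the step, and $|\phi'\rangle$ is the unit vector represented after truncation and rescaling, add to the accumulated error the truncation error $\big\||\phi\rangle\langle\phi|-|\phi'\rangle\langle\phi'|\big\|_1=2\sqrt{1-|\langle\phi|\phi'\rangle|^2}$. (4) 2-qubit gate on non-adjacent qubits: use swap gates, each treated as a 2-qubit gate on adjacent qubits as in (3) (including its truncation error), to bring the two qubits next to each other, then apply the gate as in (3). The order of the qubits is tracked accordingly. (5) Branches: for a measurement of qubit $i$ in an $\texttt{if}$ statement, the computation splits into two, with outcome $b\in\{0,1\}$ obtained by setting $A_i^{(1-b)}$ to zero. The resulting vector is normalized and its squared norm is recorded as the probability of that outcome (outcomes of probability zero are dropped). Each branch, including all code following the $\texttt{if}$, is processed separately and branches are never merged. Output: $\delta$ is the sum of all truncation errors incurred (over all steps and all branches). $\hat\rho=\sum_b p_b\,|\psi_b\rangle\langle\psi_b|$, where $b$ ranges over the final branches, $|\psi_b\rangle$ is the unit vector represented by the final MPS of branch $b$, and $p_b$ is the product of the recorded outcome probabilities along $b$. If $P$ has no $\texttt{if}$ statement, $\hat\rho=|\psi'\rangle\langle\psi'|$ for the single final MPS vector $|\psi'\rangle$. *)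

(* Defs.v *)
From HB Require Import structures.
From mathcomp Require Import all_boot all_order all_algebra all_fingroup.
From mathcomp Require Import sesquilinear spectral.

Set Implicit Arguments.
Unset Strict Implicit.
Unset Printing Implicit Defensive.

Import Order.TTheory GRing.Theory Num.Theory.

Local Open Scope ring_scope.
Local Open Scope sesquilinear_scope.

(* The computational basis of k qubits is 'I_(2 ^ k), read in big-endian binary:
   qubit 0 is the most significant bit. *)

Definition bits (k : nat) (x : 'I_(2 ^ k)) : k.-tuple bool :=
  [tuple odd (x %/ 2 ^ (k - j.+1)) | j < k].

Definition bits_val (s : seq bool) : nat :=
  foldl (fun (m : nat) (b : bool) => (m.*2 + b)%N) 0%N s.

Lemma bits_val_lt (k : nat) (s : k.-tuple bool) : (bits_val s < 2 ^ k)%N.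
Proof.
suff H (t : seq bool) m :
    (foldl (fun (m : nat) (b : bool) => m.*2 + b) m t < m.+1 * 2 ^ size t)%N.
  by have := H s 0%N; rewrite mul1n size_tuple.
elim: t m => [|b t IH] m /=; first by rewrite expn0 muln1.
apply: (leq_trans (IH _)); rewrite expnS mulnA leq_mul2r; apply/orP; right.
by rewrite muln2 doubleS -addnS -[in leqRHS]addn2 leq_add2l; case: b.
Qed.

Definition idx (k : nat) (s : k.-tuple bool) : 'I_(2 ^ k) :=
  Ordinal (bits_val_lt s).

Section Defs.
Variable C : numClosedFieldType.

(* Spectral square root; it is the positive square root when A is positive
   semidefinite, the only case in which it is used. *)
Definition sqrtmx (m : nat) (A : 'M[C]_m) : 'M[C]_m :=
  invmx (spectralmx A) *m diag_mx (map_mx sqrtC (spectral_diag A))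
    *m spectralmx A.

Definition trnorm (m : nat) (X : 'M[C]_m) : C := \tr (sqrtmx (X ^t* *m X)).

Definition sqnorm (m : nat) (v : 'cV[C]_m) : C := \sum_x `|v x 0| ^+ 2.

Definition unit_vec (m : nat) (v : 'cV[C]_m) : Prop := sqnorm v = 1.

Definition pure (m : nat) (v : 'cV[C]_m) : 'M[C]_m := v *m v ^t*.

Definition ket (n : nat) (s : n.-tuple bool) : 'cV[C]_(2 ^ n) :=
  delta_mx (idx s) 0.

Section Programs.
Variable n : nat.

Inductive prog : Type :=
| Skip
| Seq (P1 P2 : prog)
| Gate1 (q : 'I_n) (U : 'M[C]_(2 ^ 1)) of U \is unitarymx
| Gate2 (q1 q2 : 'I_n) (U : 'M[C]_(2 ^ 2)) of q1 != q2 & U \is unitarymx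
| If (q : 'I_n) (P0 P1 : prog).

(* U on the qubits listed in q, tensored with the identity on the others. *)
Definition gate_mx (k : nat) (q : k.-tuple 'I_n) (U : 'M[C]_(2 ^ k)) :
    'M[C]_(2 ^ n) :=
  \matrix_(x, y)
    if [forall j, (j \in q) || (tnth (bits x) j == tnth (bits y) j)]
    then U (idx [tuple tnth (bits x) (tnth q a) | a < k])
           (idx [tuple tnth (bits y) (tnth q a) | a < k])
    else 0.

Definition meas_mx (q : 'I_n) (b : bool) : 'M[C]_(2 ^ n) :=
  \matrix_(x, y) ((x == y) && (tnth (bits x) q == b))%:R.

Fixpoint sem (P : prog) (rho : 'M[C]_(2 ^ n)) : 'M[C]_(2 ^ n) :=
  match P with
  | Skip => rho
  | Seq P1 P2 => sem P2 (sem P1 rho)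
  | Gate1 q U _ =>
      gate_mx [tuple q] U *m rho *m (gate_mx [tuple q] U) ^t*
  | Gate2 q1 q2 U _ _ =>
      gate_mx [tuple q1; q2] U *m rho *m (gate_mx [tuple q1; q2] U) ^t*
  | If q P0 P1 =>
      sem P0 (meas_mx q false *m rho *m (meas_mx q false) ^t*)
      + sem P1 (meas_mx q true *m rho *m (meas_mx q true) ^t*)
  end.

End Programs.

Section MPS.
Variables n w : nat.

(* Dimension of the bond to the left of site j: 1 at both ends of the chain.
   For n = 1 the single site carries two scalars. *)
Definition bond (j : nat) : nat := if (0 < j < n)%N then w else 1%N.

Lemma bond_last : bond n = 1%N.
Proof. by rewrite /bond ltnn andbF. Qed.

(* Sites are numbered from 0; the values at j >= n are never used. *)
Definition mps : Type := forall j : nat, bool -> 'M[C]_(bond j, bond j.+1).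

Fixpoint mps_prod (A : mps) (s : seq bool) (j : nat) :
    'M[C]_(bond 0, bond j) :=
  if j is j'.+1 then mps_prod A s j' *m A j' (nth false s j') else 1%:M.

Definition mps_amp (A : mps) (s : n.-tuple bool) : C :=
  castmx (erefl 1%N, bond_last) (mps_prod A s n) 0 0.

Definition mps_vec (A : mps) : 'cV[C]_(2 ^ n) := \col_x mps_amp A (bits x).

Definition basis_mps (s : n.-tuple bool) : mps := fun j b =>
  if b == nth false s j
  then \matrix_(a, c) ((a == 0%N :> nat) && (c == 0%N :> nat))%:R
  else 0.

Variant mps_init (psi : 'cV[C]_(2 ^ n)) : mps -> Prop :=
| InitBasis s : psi = ket s -> mps_init psi (basis_mps s)
| InitVec A : mps_vec A = psi -> mps_init psi A.

(* The place at which the scalar factor is absorbed is left open. *)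
Definition mps_normalize (A B : mps) : Prop :=
  (exists c : nat -> C, forall j, 0 < c j /\ forall b, B j b = c j *: A j b)
  /\ unit_vec (mps_vec B).

Definition mps_gate1 (G : 'M[C]_(2 ^ 1)) (i : nat) (A : mps) : mps :=
  dfwith A (i := i)
    (fun s => \sum_(s' : bool) G (idx [tuple s]) (idx [tuple s']) *: A i s').

Definition mps_project (i : nat) (b : bool) (A : mps) : mps :=
  dfwith A (i := i) (fun s => if s == b then A i s else 0).

(* Top-left corner of X, padded with zeros. *)
Definition resize_mx (m p m' p' : nat) (X : 'M[C]_(m, p)) : 'M[C]_(m', p') :=
  pid_mx m *m X *m pid_mx p.

Definition is_svd (m p : nat) (M : 'M[C]_(m, p))
    (U : 'M[C]_m) (S : 'M[C]_(m, p)) (V : 'M[C]_p) : Prop :=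
  [/\ U \is unitarymx, V \is unitarymx, M = U *m S *m V ^t*,
      forall (i : 'I_m) (j : 'I_p),
        0 <= S i j /\ (i != j :> nat -> S i j = 0)
    & forall (i : 'I_m) (j : 'I_p) (i' : 'I_m) (j' : 'I_p),
        i = j :> nat -> i' = j' :> nat -> (i <= i')%N ->
        S i' j' <= S i j].

Definition pair_mx (G : 'M[C]_(2 ^ 2)) (i : nat) (A : mps) :
    'M[C]_(bond i + bond i, bond i.+2 + bond i.+2) :=
  let M' s t := \sum_(k : bool) \sum_(l : bool)
    G (idx [tuple s; t]) (idx [tuple k; l]) *: (A i k *m A i.+1 l) in
  block_mx (M' false false) (M' false true) (M' true false) (M' true true).

Variant gate2_trunc (G : 'M[C]_(2 ^ 2)) (i : nat) (A : mps) : mps -> Prop :=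
| Gate2Trunc U S V of is_svd (pair_mx G i A) U S V :
    let Ul : 'M[C]_(bond i + bond i, bond i.+1) := resize_mx _ _ U in
    let S' : 'M[C]_(bond i.+1) := resize_mx _ _ S in
    let R : 'M[C]_(bond i.+1, bond i.+2 + bond i.+2) :=
      S' *m resize_mx _ _ (V ^t*) in
    gate2_trunc G i A
      (dfwith (dfwith A
        (i := i) (fun s => if s then dsubmx Ul else usubmx Ul))
        (i := i.+1) (fun s => if s then rsubmx R else lsubmx R)).

(* Gate G on the adjacent sites i and i.+1, with its truncation error. *)
Variant gate2_step (G : 'M[C]_(2 ^ 2)) (i : nat) (hi : (i.+1 < n)%N)
    (A B : mps) : C -> Prop :=
| Gate2Step A' of gate2_trunc G i A A' & mps_normalize A' B :
    let phi :=
      gate_mx [tuple Ordinal (ltnW hi); Ordinal hi] G *m mps_vec A in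
    gate2_step G hi A B (trnorm (pure phi - pure (mps_vec B))).

(* (A, o): site p of A currently holds qubit o p. *)
Definition state : Type := (mps * 'S_n)%type.

Definition site (st : state) (q : 'I_n) : 'I_n := (st.2^-1)%g q.

Definition state_vec (st : state) : 'cV[C]_(2 ^ n) :=
  \col_x mps_amp st.1 [tuple tnth (bits x) (st.2 p) | p < n].

Definition flip2 (a : 'I_(2 ^ 2)) : 'I_(2 ^ 2) :=
  idx [tuple of rev (bits a)].

Definition swap_mx : 'M[C]_(2 ^ 2) := \matrix_(a, b) (a == flip2 b)%:R.

Definition flip_mx (G : 'M[C]_(2 ^ 2)) : 'M[C]_(2 ^ 2) :=
  \matrix_(a, b) G (flip2 a) (flip2 b).

Definition adjacent (st : state) (q1 q2 : 'I_n) : bool :=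
  (site st q2 == (site st q1).+1 :> nat)
  || (site st q1 == (site st q2).+1 :> nat).

(* Any sequence of swaps of neighbouring sites that ends as soon as q1 and q2
   are adjacent is allowed. *)
Inductive tn_gate2 (G : 'M[C]_(2 ^ 2)) (q1 q2 : 'I_n) :
    state -> state -> C -> Prop :=
| TnAdj i (hi : (i.+1 < n)%N) A (o : 'S_n) B d :
    o (Ordinal (ltnW hi)) = q1 -> o (Ordinal hi) = q2 ->
    gate2_step G hi A B d ->
    tn_gate2 G q1 q2 (A, o) (B, o) d
| TnAdjRev i (hi : (i.+1 < n)%N) A (o : 'S_n) B d :
    o (Ordinal (ltnW hi)) = q2 -> o (Ordinal hi) = q1 ->
    gate2_step (flip_mx G) hi A B d ->
    tn_gate2 G q1 q2 (A, o) (B, o) d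
| TnSwap i (hi : (i.+1 < n)%N) A (o : 'S_n) B d st d' :
    ~~ adjacent (A, o) q1 q2 ->
    gate2_step swap_mx hi A B d ->
    tn_gate2 G q1 q2
      (B, (tperm (Ordinal (ltnW hi)) (Ordinal hi) * o)%g) st d' ->
    tn_gate2 G q1 q2 (A, o) st (d + d').

Definition branches : Type := seq (C * state).

Definition scale_branches (p : C) (bs : branches) : branches :=
  [seq (p * b.1, b.2) | b <- bs].

(* Run the same code separately from each branch. *)
Inductive tn_each (run : state -> branches -> C -> Prop) :
    branches -> branches -> C -> Prop :=
| EachNil : tn_each run [::] [::] 0
| EachCons p st bs out d out' d' :
    run st out d -> tn_each run bs out' d' ->
    tn_each run ((p, st) :: bs) (scale_branches p out ++ out') (d + d').

Definition tn_outcome (run : state -> branches -> C -> Prop)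
    (st : state) (q : 'I_n) (b : bool) (bs : branches) (d : C) : Prop :=
  let A := mps_project (site st q) b st.1 in
  let p := sqnorm (mps_vec A) in
  if p == 0 then bs = [::] /\ d = 0
  else exists B bs', [/\ mps_normalize A B, run (B, st.2) bs' d
                       & bs = scale_branches p bs'].

(* tn_run P st bs d: executing P from st may end in the branches bs, with the
   given probabilities relative to st, and total truncation error d. *)
Fixpoint tn_run (P : prog n) (st : state) (bs : branches) (d : C) : Prop :=
  match P with
  | Skip => bs = [:: (1, st)] /\ d = 0
  | Seq P1 P2 => exists bs1 d1 d2,
      [/\ tn_run P1 st bs1 d1, tn_each (tn_run P2) bs1 bs d2 & d = d1 + d2]
  | Gate1 q U _ => bs = [:: (1, (mps_gate1 U (site st q) st.1, st.2))] /\ d = 0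
  | Gate2 q1 q2 U _ _ => exists2 st',
      tn_gate2 U q1 q2 st st' d & bs = [:: (1, st')]
  | If q P0 P1 => exists bs0 d0 bs1 d1,
      [/\ tn_outcome (tn_run P0) st q false bs0 d0,
          tn_outcome (tn_run P1) st q true bs1 d1,
          bs = bs0 ++ bs1 & d = d0 + d1]
  end.

(* A relation rather than a function, since neither the singular value
   decompositions nor the swaps are unique. *)
Definition TN (psi : 'cV[C]_(2 ^ n)) (P : prog n)
    (rho : 'M[C]_(2 ^ n)) (delta : C) : Prop :=
  exists A bs, [/\ mps_init psi A, tn_run P (A, 1%g) bs delta
                 & rho = \sum_(b <- bs) b.1 *: pure (state_vec b.2)].

End MPS.
End Defs.

Arguments TN {C n} w psi P rho delta.

(* Main.v *)
(* Any X = A - B with A and B positive semidefinite satisfies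
   |X|_1 <= tr A + tr B, with equality for the positive and negative parts of
   a Hermitian X.  The semantics of a program is linear, positive and
   trace-preserving, so it maps such a decomposition to one of the same total
   trace and hence contracts the trace norm.  By induction on the program the
   error of the mixture of branches is therefore at most the sum of the errors
   of the single steps, each weighted by a branch probability at most 1; all
   steps but truncations are exact.  The nature of the truncation is irrelevant,
   since its error is measured against the exact state. *)
Require Import Defs.
From mathcomp Require Import all_boot all_order all_algebra.
From mathcomp Require Import reals complex.
From mathcomp Require Import all_fingroup sesquilinear spectral ring.

Set Implicit Arguments.
Unset Strict Implicit.
Unset Printing Implicit Defensive.

Import Order.TTheory GRing.Theory Num.Theory.

Local Open Scope ring_scope.
Local Open Scope sesquilinear_scope.

(** * Trace norm *)

Section TraceNorm.
Variable C : numClosedFieldType.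

Lemma trmxC_mul m n p (A : 'M[C]_(m, n)) (B : 'M[C]_(n, p)) :
  (A *m B) ^t* = B ^t* *m A ^t*.
Proof. by rewrite trmx_mul map_mxM. Qed.

Lemma trmxCE m n (A : 'M[C]_(m, n)) i j : (A ^t*) i j = (A j i)^*.
Proof. by rewrite !mxE. Qed.

Lemma trmxCD m n (A B : 'M[C]_(m, n)) : (A + B) ^t* = A ^t* + B ^t*.
Proof. by rewrite linearD map_mxD. Qed.

Lemma trmxCN m n (A : 'M[C]_(m, n)) : (- A) ^t* = - A ^t*.
Proof. by rewrite linearN map_mxN. Qed.

Lemma trmxCZ m n c (A : 'M[C]_(m, n)) : (c *: A) ^t* = c^* *: A ^t*.
Proof. by apply/matrixP=> i j; rewrite !mxE rmorphM. Qed.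

Lemma unitarymxPl m (U : 'M[C]_m) : U \is unitarymx -> U ^t* *m U = 1%:M.
Proof. by move=> /unitarymxP /mulmx1C. Qed.

(** * Positive semidefinite matrices *)

Definition psd m (A : 'M[C]_m) : Prop :=
  A ^t* = A /\ forall v : 'cV_m, 0 <= (v ^t* *m A *m v) 0 0.

Lemma psdD m (A B : 'M[C]_m) : psd A -> psd B -> psd (A + B).
Proof.
move=> [hA pA] [hB pB]; split; first by rewrite trmxCD hA hB.
by move=> v; rewrite mulmxDr mulmxDl mxE addr_ge0.
Qed.

Lemma psdZ m c (A : 'M[C]_m) : 0 <= c -> psd A -> psd (c *: A).
Proof.
move=> c0 [hA pA]; split; first by rewrite trmxCZ hA geC0_conj.
by move=> v; rewrite -scalemxAr -scalemxAl mxE mulr_ge0.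
Qed.

Lemma psd_conj m p (K : 'M[C]_(p, m)) (A : 'M[C]_m) :
  psd A -> psd (K *m A *m K ^t*).
Proof.
move=> [hA pA]; split; first by rewrite !trmxC_mul trmxCK hA mulmxA.
by move=> v; have := pA (K ^t* *m v); rewrite trmxC_mul trmxCK !mulmxA.
Qed.

Lemma psd_diag m (d : 'rV[C]_m) : (forall i, 0 <= d 0 i) -> psd (diag_mx d).
Proof.
move=> d0; split.
  apply/matrixP=> i j; rewrite trmxCE !mxE eq_sym.
  by case: eqVneq => [->|_]; rewrite ?mulr0n ?conjC0 // !mulr1n geC0_conj.
move=> v; rewrite mul_mx_diag mxE; apply: sumr_ge0 => i _.
by rewrite !mxE mulrAC mulr_ge0 // mulrC mul_conjC_ge0.
Qed.

Lemma psd_entry_ge0 m (A : 'M[C]_m) i : psd A -> 0 <= A i i.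
Proof.
move=> [_ /(_ (delta_mx i 0))].
by rewrite trmx_delta map_delta_mx -rowE -colE !mxE.
Qed.

Lemma psd_tr_ge0 m (A : 'M[C]_m) : psd A -> 0 <= \tr A.
Proof. by move=> pA; apply: sumr_ge0 => i _; apply: psd_entry_ge0. Qed.

Lemma psd_pure m (v : 'cV[C]_m) : psd (pure v).
Proof.
split; first by rewrite trmxC_mul trmxCK.
move=> u; rewrite /pure mulmxA -mulmxA mxE big_ord1.
have -> : v ^t* *m u = (u ^t* *m v) ^t* by rewrite trmxC_mul trmxCK.
by rewrite trmxCE mul_conjC_ge0.
Qed.

Lemma sqnorm_tr m (v : 'cV[C]_m) : \tr (pure v) = sqnorm v.
Proof.
by apply: eq_bigr => i _; rewrite mxE big_ord1 trmxCE normCK.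
Qed.

Lemma sqnorm_ge0 m (v : 'cV[C]_m) : 0 <= sqnorm v.
Proof. by apply: sumr_ge0 => i _; rewrite exprn_ge0. Qed.

Lemma sqnorm_eq0 m (v : 'cV[C]_m) : sqnorm v = 0 -> v = 0.
Proof.
move=> /eqP; rewrite psumr_eq0 => [/allP v0|i _]; last by rewrite exprn_ge0.
apply/matrixP => i j; rewrite ord1 mxE; apply/eqP.
by have := v0 i (mem_index_enum i); rewrite sqrf_eq0 normr_eq0.
Qed.

(** Conjugation by [P] does not change the determinant of the characteristic matrix. Hence two
    unitary diagonalizations of one matrix have the same diagonal entries up to order. *)
Lemma char_poly_unitary_diag m (P : 'M[C]_m) (d : 'rV[C]_m) :
  P \is unitarymx ->
  char_poly (P ^t* *m diag_mx d *m P) = \prod_i ('X - (d 0 i)%:P).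
Proof.
move=> uP.
transitivity (char_poly (diag_mx d)); last first.
  rewrite char_poly_trig ?diag_mx_is_trig //.
  by apply: eq_bigr => i _; rewrite mxE eqxx mulr1n.
rewrite /char_poly.
have -> : char_poly_mx (P ^t* *m diag_mx d *m P) =
   map_mx polyC (P ^t*) *m char_poly_mx (diag_mx d) *m map_mx polyC P.
  rewrite /char_poly_mx mulmxBr mulmxBl !map_mxM /=; congr (_ - _).
  by rewrite scalar_mxC -mulmxA -map_mxM unitarymxPl // map_mx1 mulmx1.
rewrite !det_mulmx mulrAC -det_mulmx -map_mxM unitarymxPl // map_mx1 det1.
by rewrite mul1r.
Qed.

(** [trnorm] is read off a diagonalization of [X ^t* *m X] that is chosen independently of that of
    [X]. Squaring the eigenvalues of [X] gives a second one, and the two are compared. *)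
Lemma trnorm_herm m (X : 'M[C]_m) : X ^t* = X ->
  exists P : 'M[C]_m, exists d : 'rV[C]_m,
    [/\ P \is unitarymx, X = P ^t* *m diag_mx d *m P,
        forall i, d 0 i \is Num.real & trnorm X = \sum_i `|d 0 i|].
Proof.
move=> hX.
have hX' : X \is hermsymmx.
  by apply/is_hermitianmxP; rewrite expr0 scale1r; rewrite hX.
have /orthomx_spectralP eX := hermitian_normalmx hX'.
have uP := spectral_unitarymx X.
set P := spectralmx X in eX uP; set d := spectral_diag X in eX.
have dr i : d 0 i \is Num.real.
  by have /mxOverP := hermitian_spectral_diag_real hX'; apply.
rewrite (invmx_unitary uP) in eX.
exists P, d; split=> //.
have nY : X ^t* *m X \is normalmx.
  by apply/normalmxP; rewrite trmxC_mul trmxCK.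
have /orthomx_spectralP eY := nY.
rewrite /trnorm /sqrtmx.
have uQ := spectral_unitarymx (X ^t* *m X).
move: eY uQ; set Q := spectralmx _; set e := spectral_diag _ => eY uQ.
rewrite (invmx_unitary uQ) in eY *.
rewrite mxtrace_mulC mulmxA (unitarymxP uQ) mul1mx mxtrace_diag.
have eY2 : X ^t* *m X = P ^t* *m diag_mx (\row_i (d 0 i ^+ 2)) *m P.
  rewrite hX eX !mulmxA (mulmxtVK _ uP).
  rewrite -(mulmxA _ _ (diag_mx d)) mulmx_diag.
  by congr (_ *m _ *m _).
(* Both lists consist of the roots of the characteristic polynomial of [X ^t* *m X], with
   multiplicity. *)
have pe : perm_eq [seq e 0 i | i <- index_enum 'I_m]
                  [seq d 0 i ^+ 2 | i <- index_enum 'I_m].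
  apply: prod_XsubC_eq; rewrite !big_map.
  rewrite -(char_poly_unitary_diag _ uQ) -eY eY2 char_poly_unitary_diag //.
  by apply: eq_bigr => i _; rewrite mxE.
transitivity (\sum_(x <- [seq e 0 i | i <- index_enum 'I_m]) sqrtC x).
  by rewrite big_map; apply: eq_bigr => i _; rewrite mxE.
rewrite (perm_big _ pe) big_map; apply: eq_bigr => i _.
by rewrite -real_normK ?dr // sqrCK.
Qed.

(* The bound |X|_1 <= t, witnessed by a Jordan-type decomposition of X. *)
Definition jordan_le m (X : 'M[C]_m) (t : C) : Prop :=
  exists A B, [/\ psd A, psd B, X = A - B & \tr A + \tr B <= t].

(* In an eigenbasis of X, the i-th eigenvalue is A_ii - B_ii. *)
Lemma trnorm_jordan_le m (X : 'M[C]_m) t : jordan_le X t -> trnorm X <= t.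
Proof.
move=> [A [B [pA pB eX tX]]].
have hX : X ^t* = X by rewrite eX trmxCD trmxCN pA.1 pB.1.
have [P [d [uP eP dr ->]]] := trnorm_herm hX.
apply: le_trans tX.
have tP Y : \tr Y = \tr (P *m Y *m P ^t*).
  by rewrite [RHS]mxtrace_mulC mulmxA unitarymxPl // mul1mx.
rewrite (tP A) (tP B) -big_split /=; apply: ler_sum => i _.
have pA' := psd_conj P pA; have pB' := psd_conj P pB.
have -> : d 0 i = (P *m A *m P ^t*) i i - (P *m B *m P ^t*) i i.
  transitivity ((P *m X *m P ^t*) i i).
    rewrite eP !mulmxA (unitarymxP uP) mul1mx -mulmxA (unitarymxP uP).
    by rewrite mulmx1 mxE eqxx mulr1n.
  by rewrite eX mulmxBr mulmxBl !mxE.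
apply: le_trans (ler_normB _ _) _.
by rewrite !ger0_norm ?psd_entry_ge0.
Qed.

Lemma jordan_le_trnorm m (X : 'M[C]_m) : X ^t* = X -> jordan_le X (trnorm X).
Proof.
move=> hX; have [P [d [uP eP dr ->]]] := trnorm_herm hX.
(* Positive and negative parts of the eigenvalues: [a - b] is [d], and [a + b] is its modulus. *)
pose a := \row_i ((`|d 0 i| + d 0 i) / 2).
pose b := \row_i ((`|d 0 i| - d 0 i) / 2).
(* The double adjoint is [P], kept in the shape that [psd_conj] yields. *)
have tP e : \tr (P ^t* *m diag_mx e *m P ^t* ^t*) = \sum_i e 0 i.
  by rewrite trmxCK mxtrace_mulC mulmxA (unitarymxP uP) mul1mx mxtrace_diag.
exists (P ^t* *m diag_mx a *m P ^t* ^t*), (P ^t* *m diag_mx b *m P ^t* ^t*).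
split.
- apply/psd_conj/psd_diag => i; rewrite mxE divr_ge0 //.
  by rewrite addrC -lerBlDr sub0r real_lerNnormlW.
- apply/psd_conj/psd_diag => i; rewrite mxE divr_ge0 // subr_ge0.
  exact: real_ler_normlW.
- rewrite trmxCK -mulmxBl -mulmxBr eP; congr (_ *m _ *m _).
  apply/matrixP => i j; rewrite !mxE -mulrnBl; congr (_ *+ _); by field.
- rewrite !tP -big_split /= le_eqVlt; apply/orP; left; apply/eqP.
  apply: eq_bigr => i _; rewrite !mxE; by field.
Qed.

(** * Closure properties of [jordan_le] *)

Lemma jordan_leD m (X Y : 'M[C]_m) s t :
  jordan_le X s -> jordan_le Y t -> jordan_le (X + Y) (s + t).
Proof.
move=> [A [B [pA pB -> tX]]] [A' [B' [pA' pB' -> tY]]].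
exists (A + A'), (B + B'); split; try exact: psdD.
  by rewrite opprD addrACA.
by rewrite !mxtraceD addrACA lerD.
Qed.

Lemma jordan_leN m (X : 'M[C]_m) t : jordan_le X t -> jordan_le (- X) t.
Proof.
move=> [A [B [pA pB -> tX]]]; exists B, A; split=> //; first by rewrite opprB.
by rewrite addrC.
Qed.

Lemma jordan_le0 m : jordan_le (0 : 'M[C]_m) 0.
Proof.
have p0 : psd (0 : 'M[C]_m).
  split; first by apply/matrixP=> i j; rewrite !mxE conjC0.
  by move=> v; rewrite mulmx0 mul0mx mxE.
by exists 0, 0; split=> //; rewrite ?subr0 // !mxtrace0 addr0.
Qed.

(** Both traces are nonnegative, so a factor at most 1 can only lower their sum. The bound stays [t]
    because [delta] adds the errors of branches without weights. *)
Lemma jordan_leZ m p (X : 'M[C]_m) t :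
  0 <= p <= 1 -> jordan_le X t -> jordan_le (p *: X) t.
Proof.
move=> /andP[p0 p1] [A [B [pA pB -> tX]]].
exists (p *: A), (p *: B); split; try exact: psdZ; first by rewrite scalerBr.
rewrite !mxtraceZ -mulrDr (le_trans _ tX) // ler_piMl //.
by rewrite addr_ge0 ?psd_tr_ge0.
Qed.

(** By cyclicity of the trace, conjugating both parts by [K] keeps their traces. *)
Lemma jordan_le_isometry m p (K : 'M[C]_(p, m)) (X : 'M[C]_m) t :
  K ^t* *m K = 1%:M -> jordan_le X t -> jordan_le (K *m X *m K ^t*) t.
Proof.
move=> uK [A [B [pA pB -> tX]]].
exists (K *m A *m K ^t*), (K *m B *m K ^t*); split; try exact: psd_conj.
  by rewrite mulmxBr mulmxBl.
by rewrite ![\tr (K *m _ *m _)]mxtrace_mulC !mulmxA uK !mul1mx.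
Qed.

Lemma pure_mul m p (K : 'M[C]_(p, m)) (v : 'cV[C]_m) :
  pure (K *m v) = K *m pure v *m K ^t*.
Proof. by rewrite /pure trmxC_mul !mulmxA. Qed.

Lemma sqnorm_isometry m p (K : 'M[C]_(p, m)) (v : 'cV[C]_m) :
  K ^t* *m K = 1%:M -> sqnorm (K *m v) = sqnorm v.
Proof.
by move=> uK; rewrite -!sqnorm_tr pure_mul mxtrace_mulC mulmxA uK mul1mx.
Qed.

Lemma pureZ m (c : C) (v : 'cV[C]_m) : pure (c *: v) = `|c| ^+ 2 *: pure v.
Proof. by rewrite /pure trmxCZ -scalemxAl -scalemxAr scalerA normCK. Qed.

End TraceNorm.

(** * Gates and measurements on bit strings *)

Section Bits.

Lemma bits_val_rcons (s : seq bool) b :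
  bits_val (rcons s b) = ((bits_val s).*2 + b)%N.
Proof. by rewrite /bits_val -cats1 foldl_cat. Qed.

(** Induction from the right end: the last bit is the parity, and dropping it halves the value. *)
Lemma odd_bits_val (s : seq bool) j : (j < size s)%N ->
  odd (bits_val s %/ 2 ^ (size s - j.+1)) = nth false s j.
Proof.
elim/last_ind: s => // s b IH; rewrite size_rcons nth_rcons bits_val_rcons ltnS.
rewrite leq_eqVlt => /predU1P[-> | ltjs].
  by rewrite subnn divn1 ltnn eqxx oddD odd_double oddb.
rewrite ltjs subSn // expnS divnMA -muln2 divnMDl // (_ : b %/ 2 = 0)%N.
  by rewrite addn0 IH.
by case: b.
Qed.

Lemma idxK k : cancel (@idx k) (@bits k).
Proof.
move=> s; apply: eq_from_tnth => j; rewrite tnth_mktuple /=.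
by rewrite (tnth_nth false) -odd_bits_val ?size_tuple.
Qed.

(** An injection between finite sets of equal size is bijective, so its left inverse is
    two-sided. *)
Lemma bitsK k : cancel (@bits k) (@idx k).
Proof.
have [|g gK Kg] := inj_card_bij (can_inj (@idxK k)).
  by rewrite card_ord card_tuple card_bool.
by move=> x; rewrite -{1}(Kg x) idxK Kg.
Qed.

Lemma eq_bits k (x y : 'I_(2 ^ k)) :
  (forall j, tnth (bits x) j = tnth (bits y) j) -> x = y.
Proof.
by move=> e; rewrite -(bitsK x) -(bitsK y); congr idx; apply: eq_from_tnth.
Qed.

Lemma eq_bitsE k (x y : 'I_(2 ^ k)) :
  (x == y) = [forall j, tnth (bits x) j == tnth (bits y) j].
Proof.
apply/eqP/forallP => [-> // | e]; apply: eq_bits => j; exact/eqP.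
Qed.

Lemma tnth_bits_idx k (f : 'I_k -> bool) j :
  tnth (bits (idx [tuple f j | j < k])) j = f j.
Proof. by rewrite idxK tnth_mktuple. Qed.

End Bits.

Section Gates.
Variables (C : numClosedFieldType) (n : nat).
Implicit Types (x y z : 'I_(2 ^ n)).

(** * Splitting a basis index into its bits on a register and the remaining bits *)

Section Register.
Variables (k : nat) (q : k.-tuple 'I_n).

Definition subbits x : 'I_(2 ^ k) :=
  idx [tuple tnth (bits x) (tnth q a) | a < k].

(** Overwrites the register with [a]. The default [false] is never reached, as [index j q] is below
    [k] for [j] in [q]. *)
Definition updbits x (a : 'I_(2 ^ k)) : 'I_(2 ^ n) :=
  idx [tuple if j \in q then nth false (bits a) (index j q)
             else tnth (bits x) j | j < n].

Definition agree x y :=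
  [forall j, (j \in q) || (tnth (bits x) j == tnth (bits y) j)].

Lemma gate_mxE (U : 'M[C]_(2 ^ k)) x y :
  gate_mx q U x y = if agree x y then U (subbits x) (subbits y) else 0.
Proof. by rewrite mxE. Qed.

Lemma agreeC x y : agree x y = agree y x.
Proof. by apply: eq_forallb => j; rewrite eq_sym. Qed.

Lemma agree_updl x a z : agree (updbits x a) z = agree x z.
Proof.
apply: eq_forallb => j; rewrite tnth_bits_idx.
by case: (j \in q).
Qed.

Lemma updbitsK x y : agree x y -> updbits x (subbits y) = y.
Proof.
move=> /forallP xy; apply: eq_bits => j; rewrite tnth_bits_idx.
have := xy j; case: (boolP (j \in q)) => [jq _ | _ /eqP //].
have lt : (index j q < k)%N.
  by rewrite -[X in (_ < X)%N](size_tuple q) index_mem.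
rewrite -[index j q]/(nat_of_ord (Ordinal lt)) -tnth_nth tnth_bits_idx.
by rewrite (tnth_nth j) /= nth_index.
Qed.

Lemma eq_agree x y : (x == y) = agree x y && (subbits x == subbits y).
Proof.
apply/idP/andP => [/eqP -> | [xy /eqP e]].
  by rewrite eqxx; split=> //; apply/forallP => j; rewrite eqxx orbT.
have xx : agree x x by apply/forallP => j; rewrite eqxx orbT.
by rewrite -(updbitsK xy) -e (updbitsK xx).
Qed.

Hypothesis uq : uniq q.

Lemma subbits_upd x a : subbits (updbits x a) = a.
Proof.
apply: eq_bits => j; rewrite !tnth_bits_idx mem_tnth.
rewrite (tnth_nth (tnth q j)) index_uniq ?size_tuple //.
by rewrite -tnth_nth.
Qed.

(** The indices that agree with [x] off the register are parametrized by the register content. A sum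
    over a row of [gate_mx] thus shrinks to [2 ^ k] terms. *)
Lemma sum_agree x (F : 'I_(2 ^ n) -> C) :
  \sum_(y | agree x y) F y = \sum_a F (updbits x a).
Proof.
rewrite (reindex_onto (updbits x) subbits) => [|y]; last exact: updbitsK.
apply: eq_bigl => a; rewrite subbits_upd eqxx andbT agreeC agree_updl.
by apply/forallP => j; rewrite eqxx orbT.
Qed.

Lemma gate_mulE p (U : 'M[C]_(2 ^ k)) (M : 'M[C]_(2 ^ n, p)) x c :
  (gate_mx q U *m M) x c = \sum_a U (subbits x) a * M (updbits x a) c.
Proof.
rewrite mxE; transitivity
    (\sum_(y | agree x y) U (subbits x) (subbits y) * M y c).
  rewrite [RHS]big_mkcond; apply: eq_bigr => y _; rewrite gate_mxE.
  by case: ifP; rewrite ?mul0r.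
by rewrite sum_agree; apply: eq_bigr => a _; rewrite subbits_upd.
Qed.

Lemma gate_mxM (U V : 'M[C]_(2 ^ k)) :
  gate_mx q U *m gate_mx q V = gate_mx q (U *m V).
Proof.
apply/matrixP => x z; rewrite gate_mulE gate_mxE mxE.
under eq_bigr => a _ do rewrite gate_mxE agree_updl subbits_upd.
by case: ifP => // _; rewrite big1 // => a _; rewrite mulr0.
Qed.

Lemma gate_mx1 : gate_mx q 1%:M = 1%:M :> 'M[C]_(2 ^ n).
Proof.
apply/matrixP => x y; rewrite gate_mxE !mxE eq_agree.
by case: agree.
Qed.

Lemma gate_mx_adj (U : 'M[C]_(2 ^ k)) : (gate_mx q U) ^t* = gate_mx q (U ^t*).
Proof.
apply/matrixP => x y; rewrite trmxCE !gate_mxE trmxCE agreeC.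
by case: ifP; rewrite ?conjC0.
Qed.

(** [gate_mx q] respects products, adjoints and the identity, so unitarity of [U] carries over. *)
Lemma gate_isometry (U : 'M[C]_(2 ^ k)) : U \is unitarymx ->
  (gate_mx q U) ^t* *m gate_mx q U = 1%:M.
Proof. by move=> uU; rewrite gate_mx_adj gate_mxM unitarymxPl // gate_mx1. Qed.

End Register.

(** * Measurement projectors *)

Lemma meas_mulE p (q : 'I_n) b (M : 'M[C]_(2 ^ n, p)) x c :
  (meas_mx C q b *m M) x c = (tnth (bits x) q == b)%:R * M x c.
Proof.
rewrite mxE (bigD1 x) //= big1 => [|y nyx]; rewrite !mxE ?eqxx ?addr0 //.
by rewrite eq_sym (negPf nyx) mul0r.
Qed.

Lemma meas_mx_adj (q : 'I_n) b : (meas_mx C q b) ^t* = meas_mx C q b.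
Proof.
apply/matrixP => x y; rewrite trmxCE !mxE rmorph_nat eq_sym.
by case: eqVneq => [->|].
Qed.

Lemma meas_mx_idem (q : 'I_n) b :
  meas_mx C q b *m meas_mx C q b = meas_mx C q b.
Proof.
apply/matrixP => x y; rewrite meas_mulE !mxE.
by case: eqP; rewrite ?andbF ?mul0r // mul1r.
Qed.

Lemma meas_mx_sum (q : 'I_n) : meas_mx C q false + meas_mx C q true = 1%:M.
Proof.
apply/matrixP => x y; rewrite !mxE.
by case: eqP => _; case: (tnth _ _); rewrite /= ?addr0 ?add0r.
Qed.

Lemma sqnorm_meas (q : 'I_n) b (v : 'cV[C]_(2 ^ n)) :
  sqnorm (meas_mx C q b *m v) <= sqnorm v.
Proof.
apply: ler_sum => x _; rewrite meas_mulE.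
by case: eqP; rewrite ?mul1r // mul0r normr0 expr0n exprn_ge0.
Qed.

(** Turns a string indexed by qubits into one indexed by sites, when site [p] holds qubit [o p]. *)
Definition permbits (o : 'S_n) x : 'I_(2 ^ n) :=
  idx [tuple tnth (bits x) (o p) | p < n].

Lemma permbitsM (s t : 'S_n) x :
  permbits s (permbits t x) = permbits (s * t)%g x.
Proof. by apply: eq_bits => j; rewrite !tnth_bits_idx permM. Qed.

Lemma permbits1 x : permbits 1%g x = x.
Proof. by apply: eq_bits => j; rewrite !tnth_bits_idx perm1. Qed.

Lemma permbitsK (o : 'S_n) : cancel (permbits o) (permbits o^-1%g).
Proof. by move=> x; rewrite permbitsM mulVg permbits1. Qed.

Lemma permbitsVK (o : 'S_n) : cancel (permbits o^-1%g) (permbits o).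
Proof. by move=> x; rewrite permbitsM mulgV permbits1. Qed.

Definition permbits_mx (o : 'S_n) : 'M[C]_(2 ^ n) :=
  \matrix_(x, y) (y == permbits o x)%:R.

Lemma permbits_mulE p (o : 'S_n) (M : 'M[C]_(2 ^ n, p)) x c :
  (permbits_mx o *m M) x c = M (permbits o x) c.
Proof.
rewrite mxE (bigD1 (permbits o x)) //= big1 => [|y nyx]; rewrite !mxE.
  by rewrite eqxx mul1r addr0.
by rewrite (negPf nyx) mul0r.
Qed.

Lemma mul_permbitsE p (o : 'S_n) (M : 'M[C]_(p, 2 ^ n)) c y :
  (M *m permbits_mx o) c (permbits o y) = M c y.
Proof.
rewrite mxE (bigD1 y) //= big1 => [|z nzy]; rewrite !mxE.
  by rewrite eqxx mulr1 addr0.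
by rewrite (can_eq (permbitsK o)) eq_sym (negPf nzy) mulr0.
Qed.

(** The order is reversed because these matrices act on vectors by precomposition with
    [permbits]. *)
Lemma permbits_mxM (s t : 'S_n) :
  permbits_mx (s * t)%g = permbits_mx t *m permbits_mx s.
Proof. by apply/matrixP => x y; rewrite permbits_mulE !mxE permbitsM. Qed.

Lemma permbits_isometry (o : 'S_n) :
  (permbits_mx o) ^t* *m permbits_mx o = 1%:M.
Proof.
apply/matrixP => x y; rewrite -(permbitsVK o y) mul_permbitsE trmxCE !mxE.
by rewrite rmorph_nat.
Qed.

(** Translates a gate on the sites [q] into the same gate on the qubits [q'] that they hold. *)
Lemma gate_permbits k (q q' : k.-tuple 'I_n) (o : 'S_n) (U : 'M[C]_(2 ^ k)) :
  (forall a, tnth q' a = o (tnth q a)) ->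
  gate_mx q' U *m permbits_mx o = permbits_mx o *m gate_mx q U.
Proof.
(* With the column written as [permbits o y], both permutation matrices reduce to reindexing. *)
move=> qq'; apply/matrixP => x y; rewrite -(permbitsVK o y).
move: (permbits _ y) => {}y; rewrite mul_permbitsE permbits_mulE !gate_mxE.
have e z : subbits q' z = subbits q (permbits o z).
  by apply: eq_bits => a; rewrite !tnth_bits_idx qq'.
rewrite !e; congr (if _ then _ else _).
have mq j : (o j \in q') = (j \in q).
  apply/tnthP/tnthP => [[a]|[a ->]]; rewrite ?qq'; last by exists a.
  by move=> /perm_inj ->; exists a.
apply/forallP/forallP => H j; last by have := H (o^-1 j)%g;
  rewrite -mq !tnth_bits_idx permKV.
by have := H (o j); rewrite mq !tnth_bits_idx.
Qed.

Lemma meas_permbits (q : 'I_n) (o : 'S_n) b :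
  meas_mx C (o q) b *m permbits_mx o = permbits_mx o *m meas_mx C q b.
Proof.
apply/matrixP => x y; rewrite -(permbitsVK o y).
move: (permbits _ y) => {}y; rewrite mul_permbitsE permbits_mulE !mxE.
by rewrite (can_eq (permbitsK o)) tnth_bits_idx.
Qed.

Lemma flip2_idx a b : flip2 (idx [tuple a; b]) = idx [tuple b; a].
Proof. by rewrite /flip2 idxK; congr idx; apply: val_inj. Qed.

Lemma subbits2 (i j : 'I_n) x :
  subbits [tuple i; j] x = idx [tuple tnth (bits x) i; tnth (bits x) j].
Proof.
congr idx; apply: eq_from_tnth => a; rewrite tnth_mktuple.
by case: a => [[|[|//]] lt]; rewrite !(tnth_nth i) ?(tnth_nth false).
Qed.

(** A swap gate is merely a relabelling of qubits, which the tracked permutation can undo. *)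
Lemma gate_swap (i j : 'I_n) : i != j ->
  gate_mx [tuple i; j] (swap_mx C) = permbits_mx (tperm i j).
Proof.
move=> nij; apply/matrixP => x y; rewrite gate_mxE !mxE !subbits2 flip2_idx.
rewrite (can_eq (@idxK 2)); set s := agree _ _ _.
set t := (_ == _ :> 2.-tuple _).
suff -> : (y == permbits (tperm i j) x) = s && t by case: s.
rewrite eq_bitsE /s /agree {s}; apply/forallP/andP => [H|[/forallP H /eqP e] p].
  split; last first.
    rewrite /t -val_eqE /=.
    have := H i; have := H j; rewrite !tnth_bits_idx tpermL tpermR.
    by move=> /eqP -> /eqP ->.
  apply/forallP => p; rewrite !inE.
  case: eqVneq => //= npi; case: eqVneq => //= npj.
  by have := H p; rewrite tnth_bits_idx tpermD 1?eq_sym // => /eqP ->.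
have := H p; rewrite !inE tnth_bits_idx.
have [e1 e2] :
    tnth (bits x) i = tnth (bits y) j /\ tnth (bits x) j = tnth (bits y) i.
  by case: (congr1 val e).
case: tpermP => [-> | -> | /eqP /negPf -> /eqP /negPf -> /= /eqP -> //].
- by rewrite e2.
- by rewrite e1.
Qed.

Lemma gate_flip (i j : 'I_n) (G : 'M[C]_(2 ^ 2)) :
  gate_mx [tuple i; j] (flip_mx G) = gate_mx [tuple j; i] G.
Proof.
apply/matrixP => x y; rewrite !gate_mxE !subbits2 mxE !flip2_idx.
congr (if _ then _ else _); apply: eq_forallb => p; rewrite !inE.
by rewrite (orbC (p == i)).
Qed.

End Gates.

(** * Matrix product states *)

Section MatrixProductStates.
Variables (C : numClosedFieldType) (n w : nat).
Implicit Types (A B : mps C n w).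

Lemma mps_prod_eq A (s t : seq bool) j :
  (forall l, (l < j)%N -> nth false s l = nth false t l) ->
  mps_prod A s j = mps_prod A t j.
Proof.
elim: j => //= j IH st; rewrite st // IH // => l lj.
by rewrite st // ltnW.
Qed.

Lemma mps_prod_dfwith_out A i (f : bool -> 'M[C]_(bond n w i, bond n w i.+1))
    (s : seq bool) j :
  (j <= i)%N -> mps_prod (dfwith A f) s j = mps_prod A s j.
Proof.
elim: j => //= j IH ji; rewrite IH ?(ltnW ji) // dfwith_out //.
by rewrite neq_ltn ji orbT.
Qed.

(** The product is linear in the matrix at site [i], and using [A i k] there amounts to setting bit
    [i] to [k]. *)
Lemma mps_prod_dfwith A i (f : bool -> 'M[C]_(bond n w i, bond n w i.+1))
    (c : bool -> bool -> C) (s : seq bool) j :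
  (forall b, f b = \sum_k c b k *: A i k) -> (i < j)%N ->
  mps_prod (dfwith A f) s j =
  \sum_k c (nth false s i) k *: mps_prod A (set_nth false s i k) j.
Proof.
move=> fE; elim: j => //= j IH; rewrite ltnS leq_eqVlt => /predU1P[ij | ij].
  subst j; rewrite mps_prod_dfwith_out // dfwith_in fE mulmx_sumr.
  apply: eq_bigr => k _; rewrite -scalemxAr nth_set_nth /= eqxx.
  congr (_ *: (_ *m _)); apply: mps_prod_eq => l li.
  by rewrite nth_set_nth /= (ltn_eqF li).
rewrite IH // dfwith_out ?neq_ltn ?ij // mulmx_suml.
apply: eq_bigr => k _; rewrite -scalemxAl nth_set_nth /=.
by rewrite gtn_eqF.
Qed.

Lemma sum_bit (F : 'I_(2 ^ 1) -> C) : \sum_a F a = \sum_b F (idx [tuple b]).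
Proof.
rewrite (reindex (fun b : bool => idx [tuple b])) //; apply: onW_bij.
apply: (@Bijective _ _ _ (fun a : 'I_(2 ^ 1) => tnth (bits a) ord0)) => [b | a].
  by rewrite idxK.
by apply: eq_bits => j; rewrite idxK (tnth_nth false) (ord1 j).
Qed.

Lemma subbits1 (i : 'I_n) x : subbits [tuple i] x = idx [tuple tnth (bits x) i].
Proof. by congr idx; apply: eq_from_tnth => a; rewrite tnth_mktuple ord1. Qed.

(** Stated for an arbitrary 2 by 2 matrix [U], so that it serves both 1-qubit gates and
    projections. *)
Lemma mps_vec_dfwith A (i : 'I_n)
    (f : bool -> 'M[C]_(bond n w i, bond n w i.+1)) (U : 'M[C]_(2 ^ 1)) :
  (forall b, f b = \sum_k U (idx [tuple b]) (idx [tuple k]) *: A i k) ->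
  mps_vec (dfwith A f) = gate_mx [tuple i] U *m mps_vec A.
Proof.
move=> fE; apply/matrixP => x z; rewrite gate_mulE // sum_bit subbits1 !mxE.
rewrite /mps_amp castmxE.
pose c b k := U (idx [tuple b]) (idx [tuple k]).
rewrite (mps_prod_dfwith (c := c)) //.
rewrite summxE; apply: eq_bigr => k _; rewrite !mxE.
rewrite -tnth_nth; congr (_ * _); rewrite /mps_amp castmxE.
congr (fun_of_matrix _ _ _).
apply: mps_prod_eq => l ln.
rewrite -[l in RHS]/(nat_of_ord (Ordinal ln)) -tnth_nth tnth_bits_idx idxK.
rewrite nth_set_nth /= inE -val_eqE /=; case: eqVneq => [li|_].
  by rewrite -val_eqE /= li eqxx.
by rewrite (tnth_nth false).
Qed.

Lemma mps_vec_gate1 A (i : 'I_n) (G : 'M[C]_(2 ^ 1)) :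
  mps_vec (mps_gate1 G i A) = gate_mx [tuple i] G *m mps_vec A.
Proof. exact: mps_vec_dfwith. Qed.

Lemma mps_vec_project A (i : 'I_n) b :
  mps_vec (mps_project i b A) = meas_mx C i b *m mps_vec A.
Proof.
(* The one-qubit projector onto the basis vector [b]. *)
pose D : 'M[C]_(2 ^ 1) := \matrix_(a, c) ((a == c) && (a == idx [tuple b]))%:R.
have -> : meas_mx C i b = gate_mx [tuple i] D.
  apply/matrixP => x y; rewrite gate_mxE !mxE (eq_agree [tuple i]).
  case: agree => //=; congr (_ && _)%:R.
  by rewrite subbits1 (can_eq (@idxK 1)) -val_eqE /= eqseq_cons andbT.
apply: mps_vec_dfwith => s; rewrite big_bool !mxE !(can_eq (@idxK 1)).
rewrite -!val_eqE /= !eqseq_cons !andbT.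
by case: s; case: b {D}; rewrite /= ?scale0r ?scale1r ?addr0 ?add0r.
Qed.

(** The factors of the single sites multiply to one global scalar. *)
Lemma mps_normalize_vec A B : mps_normalize A B ->
  exists2 c : C, 0 < c & mps_vec B = c *: mps_vec A.
Proof.
move=> [[c cP] _]; exists (\prod_(l < n) c l).
  by apply: prodr_gt0 => l _; have [] := cP l.
have eB (s : seq bool) j :
    mps_prod B s j = (\prod_(l < j) c l) *: mps_prod A s j.
  elim: j => [|j IH] /=; first by rewrite big_ord0 scale1r.
  by rewrite IH (cP j).2 big_ord_recr /= -scalemxAl -scalemxAr scalerA.
by apply/matrixP => x z; rewrite !mxE /mps_amp eB !castmxE mxE.
Qed.

(* The matrix E used to initialize a basis state. *)
Definition corner_mx m p : 'M[C]_(m, p) :=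
  \matrix_(a, c) ((a == 0%N :> nat) && (c == 0%N :> nat))%:R.

(** Only the inner index 0 contributes, and it exists since [p] is positive; for bonds this is where
    [0 < w] enters. *)
Lemma corner_mxM m p r : (0 < p)%N ->
  corner_mx m p *m corner_mx p r = corner_mx m r.
Proof.
case: p => // p _; apply/matrixP => a c; rewrite mxE (bigD1 ord0) //=.
rewrite big1 => [|e ne]; rewrite !mxE.
  by rewrite addr0 eqxx andbT /= -natrM mulnb.
by rewrite (_ : (e == 0 :> nat) = false) ?andbF ?mul0r //; apply: negPf.
Qed.

Lemma mps_prod_basis (s : n.-tuple bool) (t : seq bool) j : (0 < w)%N ->
  mps_prod (basis_mps C w s) t j =
  [forall l : 'I_j, nth false t l == nth false s l]%:R *: corner_mx _ _.
Proof.
move=> w0; have bond_gt0 l : (0 < bond n w l)%N by rewrite /bond; case: ifP.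
elim: j => [|j IH] /=.
  rewrite (_ : [forall _, _]) ?scale1r; last by apply/forallP => -[].
  apply/matrixP => a c; rewrite !mxE /=.
  have l0 (b : 'I_(bond n w 0)) : b = 0%N :> nat.
    by move: b; rewrite /bond /= => b; rewrite ord1.
  by rewrite -val_eqE /= !l0.
rewrite IH /basis_mps -[\matrix_(_, _) _]/(corner_mx _ _).
have -> : [forall l : 'I_j.+1, nth false t l == nth false s l] =
    [forall l : 'I_j, nth false t l == nth false s l]
    && (nth false t j == nth false s j).
  apply/forallP/andP => [H|[/forallP H e] l].
    split; last exact: (H ord_max).
    by apply/forallP => l; apply: (H (widen_ord (leqnSn j) l)).
  have := ltn_ord l; rewrite ltnS leq_eqVlt => /predU1P[-> // | lj].
  exact: (H (Ordinal lj)).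
case: (_ == _); last by rewrite mulmx0 andbF scale0r.
by rewrite andbT -scalemxAl corner_mxM.
Qed.

Lemma mps_vec_basis (s : n.-tuple bool) : (0 < w)%N ->
  mps_vec (basis_mps C w s) = ket C s.
Proof.
move=> w0; apply/matrixP => x z.
rewrite !mxE /mps_amp castmxE mps_prod_basis //.
rewrite !mxE /= ord1 eqxx andbT mulr1 -[x == _](can_eq (@bitsK n)) idxK.
congr (_%:R); congr (nat_of_bool _).
apply/forallP/eqP => [H|<- l]; last exact: eqxx.
apply: eq_from_tnth => l.
by rewrite !(tnth_nth false); apply/eqP.
Qed.

Lemma mps_init_vec (psi : 'cV[C]_(2 ^ n)) A : (0 < w)%N ->
  mps_init psi A -> mps_vec A = psi.
Proof. by move=> w0 [s -> | //]; exact: mps_vec_basis. Qed.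

End MatrixProductStates.

(** * Error bound for the algorithm *)

Section Soundness.
Variables (C : numClosedFieldType) (n w : nat).
Implicit Types (st : state C n w) (bs : branches C n w) (P : prog C n).

(** * The semantics is linear, positive and trace-preserving *)

Lemma semD P X Y : sem P (X + Y) = sem P X + sem P Y.
Proof.
elim: P X Y => [|P1 IH1 P2 IH2|q U uU|q1 q2 U q12 uU|q P0 IH0 P1 IH1] X Y //=.
- by rewrite IH1 IH2.
- by rewrite mulmxDr mulmxDl.
- by rewrite mulmxDr mulmxDl.
- by rewrite !(mulmxDr, mulmxDl) IH0 IH1 addrACA.
Qed.

Lemma semZ P c X : sem P (c *: X) = c *: sem P X.
Proof.
elim: P X => [|P1 IH1 P2 IH2|q U uU|q1 q2 U q12 uU|q P0 IH0 P1 IH1] X //=.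
- by rewrite IH1 IH2.
- by rewrite -scalemxAr -scalemxAl.
- by rewrite -scalemxAr -scalemxAl.
- by rewrite -!(scalemxAr, scalemxAl) IH0 IH1 scalerDr.
Qed.

Lemma sem0 P : sem P 0 = 0.
Proof. by have := semZ P 0 0; rewrite !scale0r. Qed.

Lemma semB P X Y : sem P (X - Y) = sem P X - sem P Y.
Proof. by rewrite semD -scaleN1r semZ scaleN1r. Qed.

Lemma sem_psd P X : psd X -> psd (sem P X).
Proof.
elim: P X => [|P1 IH1 P2 IH2|q U uU|q1 q2 U q12 uU|q P0 IH0 P1 IH1] X pX //=.
- exact/IH2/IH1.
- exact: psd_conj.
- exact: psd_conj.
- by apply: psdD; [apply: IH0|apply: IH1]; apply: psd_conj.
Qed.

Lemma gate1_isometry (q : 'I_n) (U : 'M[C]_(2 ^ 1)) : U \is unitarymx ->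
  (gate_mx [tuple q] U) ^t* *m gate_mx [tuple q] U = 1%:M.
Proof. exact: gate_isometry. Qed.

Lemma gate2_isometry (q1 q2 : 'I_n) (U : 'M[C]_(2 ^ 2)) : q1 != q2 ->
  U \is unitarymx ->
  (gate_mx [tuple q1; q2] U) ^t* *m gate_mx [tuple q1; q2] U = 1%:M.
Proof. by move=> q12; apply: gate_isometry; rewrite /= inE q12. Qed.

(** Gates are isometries. For [If], cyclicity reduces the claim to the two idempotent projectors
    summing to the identity. *)
Lemma sem_tr P X : \tr (sem P X) = \tr X.
Proof.
elim: P X => [|P1 IH1 P2 IH2|q U uU|q1 q2 U q12 uU|q P0 IH0 P1 IH1] X //=.
- by rewrite IH2 IH1.
- by rewrite mxtrace_mulC mulmxA gate1_isometry // mul1mx.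
- by rewrite mxtrace_mulC mulmxA gate2_isometry // mul1mx.
rewrite mxtraceD IH0 IH1 ![\tr (meas_mx _ _ _ *m _ *m _)]mxtrace_mulC.
rewrite !meas_mx_adj !mulmxA !meas_mx_idem -mxtraceD -mulmxDl.
by rewrite meas_mx_sum mul1mx.
Qed.

Lemma jordan_le_sem P X t : jordan_le X t -> jordan_le (sem P X) t.
Proof.
move=> [A [B [pA pB -> tX]]]; exists (sem P A), (sem P B).
by split; rewrite ?semB ?sem_tr //; apply: sem_psd.
Qed.

Lemma state_vecE (A : mps C n w) (o : 'S_n) :
  state_vec (A, o) = permbits_mx C o *m mps_vec A.
Proof. by apply/matrixP => x z; rewrite permbits_mulE !mxE idxK. Qed.

(** The error is recorded in site order. The permutation matrix of [o] is an isometry that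
    intertwines the site gate with the qubit gate, so the bound survives in qubit order. *)
Lemma gate2_step_sound G i (hi : (i.+1 < n)%N) (A B : mps C n w) d
    (q1 q2 : 'I_n) (o : 'S_n) :
  gate2_step G hi A B d ->
  o (Ordinal (ltnW hi)) = q1 -> o (Ordinal hi) = q2 ->
  unit_vec (state_vec (B, o)) /\
  jordan_le (pure (state_vec (B, o))
        - pure (gate_mx [tuple q1; q2] G *m state_vec (A, o))) d.
Proof.
case=> A' _ [_ uB] phi o1 o2.
rewrite !state_vecE /unit_vec sqnorm_isometry ?permbits_isometry; split=> //.
rewrite mulmxA (@gate_permbits _ _ _ [tuple Ordinal (ltnW hi); Ordinal hi]).
  rewrite -mulmxA !pure_mul -mulmxBl -mulmxBr.
  apply: jordan_le_isometry; first exact: permbits_isometry.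
  (* The recorded difference is exact minus truncated, the opposite of the one bounded here. *)
  rewrite -pure_mul -[X in jordan_le X]opprB; apply/jordan_leN/jordan_le_trnorm.
  by rewrite trmxCD trmxCN !(psd_pure _).1.
by case=> [[|[|//]] lt]; rewrite !(tnth_nth q1).
Qed.

Lemma tn_gate2_sound G q1 q2 st st' d :
  q1 != q2 -> G \is unitarymx -> tn_gate2 G q1 q2 st st' d ->
  unit_vec (state_vec st') /\
  jordan_le (pure (state_vec st')
             - pure (gate_mx [tuple q1; q2] G *m state_vec st)) d.
Proof.
move=> q12 uG; elim=> [i hi A o B d' o1 o2 | i hi A o B d' o1 o2 |
  i hi A o B d1 st1 d2 _ stp _ [u1 t1]].
- by move=> /gate2_step_sound; apply.
- by move=> /gate2_step_sound /(_ o1 o2); rewrite gate_flip.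
split=> //; rewrite [d1 + d2]addrC.
set o' := (_ * o)%g in u1 t1 *.
set i0 := Ordinal (ltnW hi) in o' u1 t1 *; set i1 := Ordinal hi in o' u1 t1 *.
have [_ tB] := gate2_step_sound stp (erefl (o' i0)) (erefl (o' i1)).
have n01 : i0 != i1 by rewrite -val_eqE /= ltn_eqF.
(* Swapping the contents of two sites and updating their labels cancel out: an exact swap leaves the
   represented state alone. *)
have e : gate_mx [tuple o' i0; o' i1] (swap_mx C) *m state_vec (A, o') =
    state_vec (A, o).
  rewrite gate_swap ?(inj_eq perm_inj) // !state_vecE mulmxA -permbits_mxM.
  (* The transposition of [o' i0] and [o' i1] is the conjugate by [o'] of that of [i0] and [i1]. *)
  by rewrite -tpermJ /conjg !mulgA mulgV mul1g tperm2 mul1g.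
rewrite e in tB.
(* Compare with the exact gate after the truncated swap: the later steps cost [d2], and the swap
   error [d1] passes unchanged through the isometry [G]. *)
rewrite -(subrKA (pure (gate_mx [tuple q1; q2] G *m state_vec (B, o')))).
apply: jordan_leD => //.
rewrite !pure_mul -mulmxBl -mulmxBr; apply: jordan_le_isometry tB.
exact: gate2_isometry.
Qed.

Definition mix bs : 'M[C]_(2 ^ n) := \sum_(b <- bs) b.1 *: pure (state_vec b.2).

(** Weights are bounded one by one, with no condition on their sum; this is what [jordan_leZ] asks
    for. *)
Fixpoint wf_branches bs : Prop :=
  if bs is b :: bs' then
    [/\ 0 <= b.1 <= 1, unit_vec (state_vec b.2) & wf_branches bs']
  else True.

Lemma mix_cat bs bs' : mix (bs ++ bs') = mix bs + mix bs'.
Proof. exact: big_cat. Qed.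

Lemma mix_scale p bs : mix (scale_branches p bs) = p *: mix bs.
Proof.
rewrite /mix big_map scaler_sumr; apply: eq_bigr => b _.
by rewrite scalerA.
Qed.

Lemma mix1 st : mix [:: (1, st)] = pure (state_vec st).
Proof. by rewrite /mix big_seq1 scale1r. Qed.

Lemma wf_cat bs bs' :
  wf_branches bs -> wf_branches bs' -> wf_branches (bs ++ bs').
Proof. by move=> + wf'; elim: bs => //= b bs IH [pb ub /IH]. Qed.

Lemma wf_scale p bs : 0 <= p <= 1 -> wf_branches bs ->
  wf_branches (scale_branches p bs).
Proof.
move=> /andP[p0 p1]; elim: bs => //= b bs IH [/andP[b0 b1] ub /IH wf].
by split=> //; rewrite mulr_ge0 // mulr_ile1.
Qed.

(** The induction invariant, stated for an abstract [run] so that sequencing and branching can be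
    treated before the induction on programs. *)
Definition sound_run P (run : state C n w -> branches C n w -> C -> Prop) :=
  forall st bs d, run st bs d -> unit_vec (state_vec st) ->
  wf_branches bs /\ jordan_le (mix bs - sem P (pure (state_vec st))) d.

Lemma tn_each_sound P run bs out d : sound_run P run ->
  tn_each run bs out d -> wf_branches bs ->
  wf_branches out /\ jordan_le (mix out - sem P (mix bs)) d.
Proof.
move=> sr; elim=> [_|p st bs' out' d1 out'' d2 /sr srun _ IH /= [pp ust wf]].
  by split=> //; rewrite /mix !big_nil sem0 subr0; apply: jordan_le0.
have [wf1 t1] := srun ust; have [wf2 t2] := IH wf.
split; first by apply: wf_cat => //; apply: wf_scale.
rewrite mix_cat mix_scale [X in sem P X]big_cons semD semZ opprD addrACA.
by rewrite -scalerBr; apply: jordan_leD => //; apply: jordan_leZ.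
Qed.

(** Projection and rescaling are exact: the projected state is [p] times the normalized one, so by
    linearity of [sem] only the error of the branch body remains. *)
Lemma tn_outcome_sound P run st q b bs d : sound_run P run ->
  unit_vec (state_vec st) -> tn_outcome run st q b bs d ->
  wf_branches bs /\
  jordan_le (mix bs - sem P (meas_mx C q b *m pure (state_vec st)
                          *m (meas_mx C q b) ^t*)) d.
Proof.
case: st => A o sr ust; rewrite /tn_outcome /= -pure_mul.
set A' := mps_project _ _ _.
have eA' : meas_mx C q b *m state_vec (A, o) = permbits_mx C o *m mps_vec A'.
  by rewrite mps_vec_project state_vecE !mulmxA -meas_permbits /site /= permKV.
have sA' : sqnorm (meas_mx C q b *m state_vec (A, o)) = sqnorm (mps_vec A').
  by rewrite eA' sqnorm_isometry // permbits_isometry.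
case: eqP => [p0 [-> ->] | _ [B [bs' [nB rB ->]]]].
  (* Probability zero forces the projected vector to vanish, so dropping the branch loses
     nothing. *)
  split=> //; rewrite (sqnorm_eq0 (etrans sA' p0)).
  rewrite /pure mul0mx sem0 /mix big_nil subr0; exact: jordan_le0.
have [c c0 eB] := mps_normalize_vec nB.
have uB : unit_vec (state_vec (B, o)).
  by rewrite state_vecE /unit_vec sqnorm_isometry ?permbits_isometry ?nB.2.
have [wf t] := sr _ _ _ rB uB.
set p := sqnorm _.
(* [c] is the rescaling factor, and the rescaled vector has norm 1. *)
have cp : `|c| ^+ 2 * p = 1.
  rewrite -[RHS]nB.2 eB -!sqnorm_tr pureZ mxtraceZ; congr (_ * _).
  by rewrite /p sqnorm_tr.
have p01 : 0 <= p <= 1.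
  by rewrite sqnorm_ge0 /p -sA' -ust sqnorm_meas.
have eP : pure (meas_mx C q b *m state_vec (A, o)) =
    p *: pure (state_vec (B, o)).
  by rewrite eA' state_vecE eB -scalemxAr pureZ scalerA mulrC cp scale1r.
split; first exact: wf_scale.
by rewrite eP semZ mix_scale -scalerBr; apply: jordan_leZ.
Qed.

Lemma tn_run_sound P : sound_run P (tn_run P).
Proof.
elim: P => [|P1 IH1 P2 IH2|q U uU|q1 q2 U q12 uU|q P0 IH0 P1 IH1] st bs d /=.
- move=> [-> ->] ust; split; first by rewrite /= lexx ler01.
  by rewrite mix1 subrr; apply: jordan_le0.
- move=> [bs1 [d1 [d2 [/IH1 r1 r2 ->]]]] /r1[wf1 t1].
  have [wf t] := tn_each_sound IH2 r2 wf1; split=> //.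
  (* Compare with running [P2] exactly on the approximate intermediate mixture; [P2] does not
     increase the error made by [P1]. *)
  rewrite -(subrKA (sem P2 (mix bs1))) [d1 + d2]addrC; apply: jordan_leD => //.
  by rewrite -semB; apply: jordan_le_sem.
- case: st => A o [-> ->] ust.
  have e : state_vec (mps_gate1 U (site (A, o) q) A, o) =
      gate_mx [tuple q] U *m state_vec (A, o).
    rewrite !state_vecE mps_vec_gate1 !mulmxA; congr (_ *m _); apply/esym.
    apply: gate_permbits => a.
    by rewrite !(tnth_nth q) (ord1 a) /= /site permKV.
  split; last by rewrite mix1 e pure_mul subrr; apply: jordan_le0.
  rewrite /= lexx ler01 e; split=> //.
  by rewrite /unit_vec sqnorm_isometry // gate1_isometry.
- move=> [st' /(tn_gate2_sound q12 uU)[u t] ->] ust.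
  by rewrite mix1 -pure_mul; split=> //; rewrite /= lexx ler01.
move=> [bs0 [d0 [bs1 [d1 [r0 r1 -> ->]]]]] ust.
have [wf0 t0] := tn_outcome_sound IH0 ust r0.
have [wf1 t1] := tn_outcome_sound IH1 ust r1.
split; first exact: wf_cat.
by rewrite mix_cat opprD addrACA; apply: jordan_leD.
Qed.

Lemma TN_sound (psi : 'cV[C]_(2 ^ n)) P rho delta : (0 < w)%N ->
  unit_vec psi -> TN w psi P rho delta ->
  jordan_le (rho - sem P (pure psi)) delta.
Proof.
move=> w0 upsi [A [bs [iA r ->]]].
(* Initially site [p] holds qubit [p]. *)
have ev : state_vec (A, 1%g) = psi.
  rewrite state_vecE -(mps_init_vec w0 iA); apply/matrixP => x z.
  by rewrite permbits_mulE permbits1.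
have ust : unit_vec (state_vec (A, 1%g : 'S_n)) by rewrite ev.
by have [_] := tn_run_sound r ust; rewrite ev.
Qed.

End Soundness.

Theorem theorem5p1 (R : realType) (n w : nat) (n_ge1 : (1 <= n)%N)
    (w_ge1 : (1 <= w)%N) (P : prog R[i] n) (psi : 'cV[R[i]]_(2 ^ n))
    (psi_unit : unit_vec psi) (rhohat : 'M[R[i]]_(2 ^ n)) (delta : R[i])
    (outTN : TN w psi P rhohat delta) :
  trnorm (rhohat - sem P (pure psi)) <= delta.
Proof. exact: trnorm_jordan_le (TN_sound w_ge1 psi_unit outTN). Qed.
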